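(* For every integer $n\ge 34$, $$\max\{f(P(n),M): M\in\mathcal{M}_2(P(n))\}=\left\lceil \frac{n+3}{7}\right\rceil+\delta(n),$$ where $\delta(n)=1$ if $n\equiv 3\pmod 7$, and $\delta(n)=0$ otherwise.
   Context: For $n\ge 3$, $P(n)=P(n,2)$ is the simple graph with vertex set $\{u_i,v_i:0\le i\le n-1\}$ and edge set $\{u_iu_{i+2},\,u_iv_i,\,v_iv_{i+1}:0\le i\le n-1\}$, subscripts modulo $n$. The edges $u_iv_i$ are called spokes. For a perfect matching $M$ of a graph $G$, a forcing set of $M$ is a subset $S\subseteq M$ contained in no perfect matching of $G$ other than $M$; the forcing number $f(G,M)$ is the minimum cardinality of a forcing set of $M$. $\mathcal{M}_2(P(n))$ is the set of perfect matchings $M$ of $P(n)$ such that either (i) $M$ contains at least one spoke, and for any two (cyclically) consecutive spokes $u_iv_i,u_jv_j$ of $M$ the number of spokes $u_kv_k$ of $P(n)$ strictly between them, $j-i-1$ (with $j$ taken as the representative in $(i,i+n]$), is $\equiv 2\pmod 4$ (if $M$ has exactly one spoke $u_iv_i$, it is regarded as two consecutive spokes with $j=i+n$, so the number is $n-1$); or (ii) $M$ contains no spoke, $4\mid n$, and for some $i$, $M=\bigcup_{k=0}^{n/4-1}\{u_{i+4k}u_{i+4k+2},\,u_{i+4k+1}u_{i+4k+3},\,v_{i+4k+1}v_{i+4k+2},\,v_{i+4k+3}v_{i+4k+4}\}$. *)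

(* Defs.v *)
From mathcomp Require Import all_boot all_order all_algebra.

Set Implicit Arguments.
Unset Strict Implicit.
Unset Printing Implicit Defensive.

Import GRing.Theory.
Local Open Scope ring_scope.

(** A simple graph on the vertex type [T] is given by its edge set
    [E : {set {set T}}], an edge being the set of its two endpoints. *)

Section Forcing.
Variables (T : finType) (E : {set {set T}}).

Definition perfect_matching (M : {set {set T}}) : bool :=
  (M \subset E) && partition M [set: T].

Definition forcing_set (M S : {set {set T}}) : bool :=
  (S \subset M) &&
  [forall M' : {set {set T}},
     perfect_matching M' ==> (S \subset M') ==> (M' == M)].

(** A perfect matching [M] is a forcing set of itself, so the starting point
    [M] of the minimum satisfies the constraint. *)
Definition forcing_number (M : {set {set T}}) : nat :=
  #|[arg min_(S < M | forcing_set M S) #|S|]|.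

End Forcing.

(** Subscripts live in ['Z_n], which is the ring of integers modulo [n] only
    for [n >= 2]; all definitions below are meant for [n >= 3], where the three
    families of edges consist of genuine two-element sets. *)

Definition vertex (n : nat) : finType := ('Z_n + 'Z_n)%type.
Definition u (n : nat) (i : 'Z_n) : vertex n := inl i.
Definition v (n : nat) (i : 'Z_n) : vertex n := inr i.

Definition spoke (n : nat) (i : 'Z_n) : {set vertex n} := [set u i; v i].

Definition P (n : nat) : {set {set vertex n}} :=
  [set [set u i; u (i + 2%:R)] | i : 'Z_n]
  :|: [set spoke i | i : 'Z_n]
  :|: [set [set v i; v (i + 1)] | i : 'Z_n].

(** The spokes of [M] at [i] and [i + g + 1] are consecutive, i.e. exactly [g]
    spokes of [P n] lie strictly between them and none of these is in [M].
    For [g = n - 1] this says that [spoke i] is the only spoke of [M]. *)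
Definition consecutive_spokes (n : nat) (M : {set {set vertex n}})
    (i : 'Z_n) (g : nat) : bool :=
  [&& spoke i \in M, spoke (i + g.+1%:R) \in M
    & [forall h : 'I_g, spoke (i + h.+1%:R) \notin M]].

Definition gaps_2_mod_4 (n : nat) (M : {set {set vertex n}}) : bool :=
  [exists i : 'Z_n, spoke i \in M] &&
  [forall i : 'Z_n, forall g : 'I_n,
     consecutive_spokes M i g ==> (g == 2 %[mod 4])%N].

Definition spokeless_matching (n : nat) (i : 'Z_n) : {set {set vertex n}} :=
  \bigcup_(k < n %/ 4)
    [set [set u (i + (4 * k)%:R);     u (i + (4 * k + 2)%:R)];
         [set u (i + (4 * k + 1)%:R); u (i + (4 * k + 3)%:R)];
         [set v (i + (4 * k + 1)%:R); v (i + (4 * k + 2)%:R)];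
         [set v (i + (4 * k + 3)%:R); v (i + (4 * k + 4)%:R)]].

Definition spokeless_periodic (n : nat) (M : {set {set vertex n}}) : bool :=
  [&& [forall i : 'Z_n, spoke i \notin M], (4 %| n)%N
    & [exists i : 'Z_n, M == spokeless_matching i]].

Definition M2 (n : nat) : {set {set {set vertex n}}} :=
  [set M | perfect_matching (P n) M
           && (gaps_2_mod_4 M || spokeless_periodic M)].

Definition delta (n : nat) : nat := (n == 3 %[mod 7])%N.

(* Main.v *)
(** Cut [P n] just before position [i].  A matching meets the cut in a subset of
    three edges, and the condition that [u_i] and [v_i] are covered exactly once
    turns perfect matchings into closed walks of length [n] on the eight subsets.
    The parity of the subset is constant along a walk, and M_2 consists of the odd
    walks.  There a walk is a cyclic tiling by tiles of length 3 (starting with a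
    spoke) and 4 (without spoke); exchanging neighbours [3 4] for [4 3] gives
    disjoint alternating cycles, whence the rate [n / 7], attained by tilings that
    are essentially [3 4 3 4 ...].

    Reading a fixed walk from left to right, a partial choice of forcing edges only
    matters through its cost and through the relation "some walk other than the
    given one, compatible with the choice, leads from e to f".  Keeping only the
    pairs (relation, cost) that are minimal for inclusion and cost, one obtains
    finite profiles that become periodic, with cost growing by 1 every 7 positions.
    For the upper bound all tilings are followed at once, keeping only the worst
    profiles; for the lower bound one tiling is followed for each residue mod 7.
    Both periodicities are checked by computation. *)

Require Import Defs.
From mathcomp Require Import all_boot all_order all_algebra.

Set Implicit Arguments.
Unset Strict Implicit.
Unset Printing Implicit Defensive.

(** The state before position [i] of a matching [M] tells which of the edges
    [v_(i-1) v_i], [u_(i-2) u_i], [u_(i-1) u_(i+1)] are in [M].  The same type is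
    used for subsets of the edges [u_i v_i], [v_i v_(i+1)], [u_i u_(i+2)] which
    belong to position [i]. *)
Definition state := (bool * bool * bool)%type.

Definition triples : seq state :=
  [seq (ab, c) | ab <- [seq (a, b) | a <- [:: false; true], b <- [:: false; true]],
                 c <- [:: false; true]].

Arguments triples : simpl never.

Lemma mem_triples t : t \in triples.
Proof. by case: t => [[[] []] []]. Qed.

(** The edge [u_(i-1) u_(i+1)] crosses two successive cuts, whence [b' == c]. The final equality
    says that the rim edges miss [v_i] exactly when the inner edges miss [u_i]; the spoke then
    covers both. *)
Definition nxt : rel state := fun e f =>
  let: (a, b, c) := e in let: (a', b', c') := f in
  [&& b' == c, ~~ (a && a'), ~~ (b && c') & (~~ a && ~~ a') == (~~ b && ~~ c')].

Definition edges_at (e f : state) : state := (~~ e.1.1 && ~~ f.1.1, f.1.1, f.2).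

Definition subt (s t : state) : bool :=
  [&& s.1.1 ==> t.1.1, s.1.2 ==> t.1.2 & s.2 ==> t.2].

Definition wt (s : state) : nat := s.1.1 + s.1.2 + s.2.

Definition allowed (s e f : state) : bool := nxt e f && subt s (edges_at e f).

(* [if] instead of [&&], as the latter evaluates both arguments under [vm_compute]. *)
Definition extend (x0 x y s : state) (R : rel state)
    (e f : state) : bool :=
  has (fun g => if R e g then allowed s g f else false) triples
  || (if e == x0 then allowed s x f && (f != y) else false).

(** An alternative either prolongs one that has already left [x], or follows [x] up to the last step
    and leaves it there. *)
Lemma extendP x0 x y s (R : rel state) e f :
  reflect ((exists2 g, R e g & allowed s g f)
           \/ [/\ e = x0, allowed s x f & f <> y]) (extend x0 x y s R e f).
Proof.
apply: (iffP orP) => -[].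
- by move=> /hasP[g _]; case: ifP => // Rg sg; left; exists g.
- by case: eqP => // -> /andP[? /eqP ?]; right.
- by move=> [g Rg sg]; left; apply/hasP; exists g; rewrite ?mem_triples ?Rg.
- by move=> [-> -> /eqP->]; right; rewrite eqxx.
Qed.

(** [alt x s i e f]: some walk of length [i] from [e] to [f] that contains the
    chosen edges [s] differs from the reference walk [x]. *)
Fixpoint alt (x s : nat -> state) (i : nat) : rel state :=
  if i is j.+1 then extend (x 0) (x j) (x i) (s j) (alt x s j)
  else fun e f => (e == f) && (e != x 0).

(** * Alternatives to a reference walk *)

Section Alternatives.
Variables (x s : nat -> state).

(** Induction on the length, according to whether [z] has left [x] yet. If [alt] has no diagonal
    pair, every compatible closed walk therefore agrees with [x]. *)
Lemma alt_sound z i : (forall j, j < i -> allowed (s j) (z j) (z j.+1)) ->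
  (forall j, j <= i -> z j = x j) \/ alt x s i (z 0) (z i).
Proof.
elim: i => [|i IH] zP.
  case: (eqVneq (z 0) (x 0)) => [e|ne]; last by right; rewrite /= eqxx.
  by left=> j; rewrite leqn0 => /eqP->.
case: IH => [j ji|zx|a]; first exact/zP/leqW.
- case: (eqVneq (z i.+1) (x i.+1)) => [e|ne].
    by left=> j; rewrite leq_eqVlt => /predU1P[->//|]; exact: zx.
  right; apply/extendP; right; split; [exact: zx| |exact/eqP].
  by rewrite -zx //; exact: zP.
- by right; apply/extendP; left; exists (z i) => //; exact: zP.
Qed.

(** The reference walk has to be compatible with the choices because the rebuilt alternative may
    follow it until departing. *)
Lemma alt_complete i e f :
    (forall j, j < i -> allowed (s j) (x j) (x j.+1)) -> alt x s i e f ->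
  exists z, [/\ z 0 = e, z i = f, forall j, j < i -> allowed (s j) (z j) (z j.+1)
    & exists2 j, j <= i & z j <> x j].
Proof.
elim: i f => [|i IH] f xP.
  move=> /andP[/eqP <- /eqP ne]; exists (fun=> e); split=> //; by exists 0.
have xP' j : j < i -> allowed (s j) (x j) (x j.+1) by move=> ?; exact/xP/leqW.
case/extendP => [[g /(IH _ xP')[z [z0 zi zP [j ji zj]]] gf]|[-> xf fx]].
  exists (fun k => if k <= i then z k else f); split => //.
  - by rewrite ltnn.
  - move=> k; rewrite ltnS => ki; rewrite ki.
    case: ltngtP ki => // [ki _|-> _]; [exact: zP|by rewrite zi].
  - by exists j; [exact: leqW|rewrite ji].
exists (fun k => if k <= i then x k else f); split => //.
- by rewrite ltnn.
- move=> k; rewrite ltnS => ki; rewrite ki.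
  by case: ltngtP ki => // [ki _|-> _]; [exact/xP/leqW|].
- by exists i.+1; rewrite // ltnn.
Qed.

End Alternatives.

Lemma eq_alt x s t i : (forall j, j < i -> s j = t j) -> alt x s i =2 alt x t i.
Proof.
elim: i => //= i IH st e f; rewrite st // /extend; congr (_ || _).
by apply: eq_has => g; rewrite IH // => j ji; exact/st/leqW.
Qed.

(** * Profiles *)

(** A function on the eight states stored as a tree of values, so that under [vm_compute] a relation
    is evaluated once and afterwards only looked up. *)
Definition table (T : Type) := (T * T * (T * T) * (T * T * (T * T)))%type.

Definition tabulate (T : Type) (f : state -> T) : table T :=
  let g a := ((f (a, false, false), f (a, false, true)),
              (f (a, true, false), f (a, true, true))) in
  (g false, g true).

Definition lookup (T : Type) (t : table T) (e : state) : T :=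
  let: (a, b, c) := e in
  let p := if a then t.2 else t.1 in
  let q := if b then p.2 else p.1 in
  if c then q.2 else q.1.

Lemma tabulateK T (f : state -> T) e : lookup (tabulate f) e = f e.
Proof. by case: e => [[[] []] []]. Qed.

Definition relation := table (table bool).
Definition holds (R : relation) (e f : state) : bool := lookup (lookup R e) f.
Definition memo (R : rel state) : relation :=
  tabulate (fun e => tabulate (R e)).

Lemma memoK R e f : holds (memo R) e f = R e f.
Proof. by rewrite /holds !tabulateK. Qed.

Definition subrelation (R Q : relation) : bool :=
  all (fun e => all (fun f => if holds R e f then holds Q e f else true) triples) triples.

Lemma subrelationP R Q :
  reflect (forall e f, holds R e f -> holds Q e f) (subrelation R Q).
Proof.
apply: (iffP allP) => [RQ e f|RQ e _].
  by have /allP/(_ f)/[!mem_triples]/(_ isT) := RQ e (mem_triples e); case: ifP.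
by apply/allP => f _; case: ifP => // /RQ.
Qed.

Definition item := (relation * nat)%type.
Definition item_le (p q : item) : bool :=
  if p.2 <= q.2 then subrelation p.1 q.1 else false.

Lemma item_leP p q : reflect
  ((forall e f, holds p.1 e f -> holds q.1 e f) /\ p.2 <= q.2) (item_le p q).
Proof.
rewrite /item_le; case: (leqP p.2 q.2) => c; last by constructor => -[].
by apply: (iffP (subrelationP _ _)) => [|[]].
Qed.

Lemma item_le_refl : reflexive item_le.
Proof. by move=> p; apply/item_leP. Qed.

Lemma item_le_trans : transitive item_le.
Proof.
move=> q p r /item_leP[pq pq2] /item_leP[qr qr2]; apply/item_leP.
by split=> [e f /pq/qr//|]; apply: leq_trans qr2.
Qed.

(** * Pruning a list to its minimal elements *)

Section Prune.
Variables (T : eqType) (le : rel T).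

Fixpoint prune (s : seq T) : seq T :=
  if s is a :: s' then
    let k := prune s' in
    if has (le^~ a) k then k else a :: filter (fun b => ~~ le a b) k
  else [::].

Lemma mem_prune s : {subset prune s <= s}.
Proof.
elim: s => //= a s IH b; case: ifP => _; first by move/IH; rewrite inE orbC => ->.
by rewrite !inE mem_filter => /predU1P[->|/andP[_ /IH->]]; rewrite ?eqxx ?orbT.
Qed.

Lemma prune_le s a : reflexive le -> transitive le ->
  a \in s -> exists2 b, b \in prune s & le b a.
Proof.
move=> le_refl le_trans; elim: s => //= b s IH; rewrite inE.
case: ifP => [/hasP[c cs cb] /predU1P[->|//]|_]; first by exists c.
case/predU1P => [->|/IH[c cs ca]]; first by exists b; rewrite ?mem_head.
case: (boolP (le b c)) => bc.
  by exists b; [exact: mem_head|exact: le_trans ca].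
by exists c; rewrite // inE mem_filter bc cs orbT.
Qed.

End Prune.

Definition profile := seq item.

Definition choices (t : state) : seq state := [seq s <- triples | subt s t].
Arguments choices : simpl never.

Lemma mem_choices s t : (s \in choices t) = subt s t.
Proof. by rewrite mem_filter mem_triples andbT. Qed.

(* A choice after which an alternative joins the reference walk [x] again is
   dropped: it cannot be completed to a forcing set. *)
Definition pstep (x0 x y : state) (P : profile) : profile :=
  prune item_le
    [seq q <- [seq (memo (extend x0 x y s (holds p.1)), p.2 + wt s)
                | p <- P, s <- choices (edges_at x y)]
       | ~~ holds q.1 x0 y].

Definition profile0 (x0 : state) : profile :=
  [:: (memo (fun e f => (e == f) && (e != x0)), 0)].

Definition shift (d : nat) (P : profile) : profile :=
  [seq (p.1, p.2 + d) | p <- P].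

Definition dominates (P Q : profile) : bool :=
  all (fun q => has (item_le^~ q) P) Q.

Lemma dominatesP P Q :
  reflect (forall q, q \in Q -> exists2 p, p \in P & item_le p q) (dominates P Q).
Proof. by apply: (iffP allP) => PQ q /PQ /hasP. Qed.

(** An alternative that ends in its initial state is a closed walk, that is, another perfect
    matching; irreflexivity at length [n] certifies a forcing choice. *)
Definition irreflexiveb (R : relation) : bool := all (fun e => ~~ holds R e e) triples.

(** The odd states: without spoke B0 -> B1 -> B2 -> B3 -> B0, with spoke B0 -> B2. *)
Definition B0 : state := (false, false, true).
Definition B1 : state := (true, true, true).
Definition B2 : state := (false, true, false).
Definition B3 : state := (true, false, false).

Definition node := (state * profile)%type.
(* A weaker profile makes a stronger one at the same state redundant, since the
   upper bound has to hold for the worst matching. *)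
Definition node_le (m n : node) : bool :=
  if m.1 == n.1 then dominates n.2 m.2 else false.

Definition succs (spokes : bool) (x : state) : seq state :=
  [seq y <- triples | nxt x y && (spokes || ~~ (edges_at x y).1.1)].

Arguments succs : simpl never.

Lemma mem_succs spokes x y :
  (y \in succs spokes x) = nxt x y && (spokes || ~~ (edges_at x y).1.1).
Proof. by rewrite mem_filter mem_triples andbT. Qed.

Definition frontier_step (spokes : bool) (x0 : state) (X : seq node) : seq node :=
  prune node_le [seq (y, pstep x0 n.1 y n.2) | n <- X, y <- succs spokes n.1].

(* All edges of the first position are chosen: this keeps the profiles small and
   still yields the sharp bound. *)
Definition frontier1 (x0 x1 : state) : seq node :=
  let s := edges_at x0 x1 in
  [:: (x1, [:: (memo (extend x0 x0 x1 s (fun e f => (e == f) && (e != x0))), wt s)])].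

Lemma mem_pstep x0 x y P q : q \in pstep x0 x y P ->
  exists2 p, p \in P & exists2 s, subt s (edges_at x y) &
  q = (memo (extend x0 x y s (holds p.1)), p.2 + wt s).
Proof.
move=> /mem_prune; rewrite mem_filter => /andP[_ /allpairsP[[p s] /= [pP]]].
by rewrite mem_choices => sub ->; exists p => //; exists s.
Qed.

(** Completeness of a step, for the lower bound: a choice that survives the filter is represented,
    after pruning, by an item that is no larger. *)
Lemma pstep_le x0 x y P p s : p \in P -> subt s (edges_at x y) ->
    ~~ extend x0 x y s (holds p.1) x0 y ->
  exists2 q, q \in pstep x0 x y P &
    item_le q (memo (extend x0 x y s (holds p.1)), p.2 + wt s).
Proof.
move=> pP sub alive; apply: prune_le item_le_refl item_le_trans _.
rewrite mem_filter memoK alive; apply/allpairsP; exists (p, s); split=> //=.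
by rewrite mem_choices.
Qed.

Lemma extend_mono x0 x y s (R Q : rel state) e f :
    (forall e f, R e f -> Q e f) ->
  extend x0 x y s R e f -> extend x0 x y s Q e f.
Proof.
move=> RQ /extendP[[g /RQ Qg sg]|h]; apply/extendP; last by right.
by left; exists g.
Qed.

(** * Upper bound for walks *)

Section Upper.

(** Meaning of a profile for the upper bound: each item overestimates some actual choice, in cost
    and in alternatives, so larger items may replace smaller ones. *)
Definition achievable (x : nat -> state) (i : nat) (P : profile) : Prop :=
  forall p, p \in P -> exists s : nat -> state,
    [/\ forall j, j < i -> subt (s j) (edges_at (x j) (x j.+1)),
        \sum_(j < i) wt (s j) <= p.2
      & forall e f, alt x s i e f -> holds p.1 e f].

Lemma achievable_step x i P : achievable x i P ->
  achievable x i.+1 (pstep (x 0) (x i) (x i.+1) P).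
Proof.
move=> aP q /mem_pstep[p /aP[s [s_sub s_wt s_alt]] [t t_sub ->]].
exists (fun j => if j < i then s j else t); split.
- move=> j; rewrite ltnS leq_eqVlt => /predU1P[->|ji]; first by rewrite ltnn.
  by rewrite ji; exact: s_sub.
- rewrite big_ord_recr /= ltnn leq_add2r.
  by under eq_bigr => j _ do rewrite ltn_ord.
- move=> e f; rewrite memoK /= ltnn; apply: extend_mono => e' f'.
  by rewrite (@eq_alt _ _ s) => [/s_alt//|j ->].
Qed.

Lemma achievable_dominates x i P Q :
  achievable x i P -> dominates P Q -> achievable x i Q.
Proof.
move=> aP /dominatesP PQ q /PQ[p /aP[s [s_sub s_wt s_alt]] /item_leP[pq pq2]].
by exists s; split=> // [|e f /s_alt/pq//]; exact: leq_trans pq2.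
Qed.

Definition steps (spokes : bool) (x : nat -> state) (i : nat) : Prop :=
  forall j, j < i -> x j.+1 \in succs spokes (x j).

(** The profiles in [X] store costs reduced by [d]; this normalization lets the same list recur
    after a period. *)
Definition frontier (spokes : bool) (x0 x1 : state) (i : nat) (X : seq node)
    (d : nat) : Prop :=
  forall x, x 0 = x0 -> x 1 = x1 -> steps spokes x i ->
  exists2 P, (x i, P) \in X & achievable x i (shift d P).

Lemma node_le_refl : reflexive node_le.
Proof.
move=> n; rewrite /node_le eqxx; apply/dominatesP => q qn.
by exists q => //; exact: item_le_refl.
Qed.

Lemma dominates_trans : transitive dominates.
Proof.
move=> Q P R /dominatesP PQ /dominatesP QR; apply/dominatesP => r.
move=> /QR[q /PQ[p pP pq] qr]; exists p => //; exact: item_le_trans qr.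
Qed.

Lemma node_le_trans : transitive node_le.
Proof.
move=> n m k; rewrite /node_le; case: eqP => // -> mn; case: ifP => // _ nk.
exact: dominates_trans mn.
Qed.

Lemma dominates_shift d P Q : dominates (shift d P) (shift d Q) = dominates P Q.
Proof.
rewrite /dominates all_map; apply: eq_all => q /=; rewrite has_map.
by apply: eq_has => p /=; rewrite /item_le /= leq_add2r.
Qed.

Lemma shift_shift d e P : shift d (shift e P) = shift (e + d) P.
Proof. by rewrite /shift -map_comp; apply: eq_map => p /=; rewrite addnA. Qed.

(** Costs are only added to and compared with each other, so a uniform shift commutes with a step;
    this lets one checked period be repeated. *)
Lemma pstep_shift x0 x y d P : pstep x0 x y (shift d P) = shift d (pstep x0 x y P).
Proof.
have prune_shift s : prune item_le (shift d s) = shift d (prune item_le s).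
  elim: s => //= p s ->; rewrite /shift has_map.
  set h := has _ _; set h' := has _ _; have -> : h = h'.
    by apply: eq_has => q /=; rewrite /item_le /= leq_add2r.
  case: h' => //=; rewrite filter_map; congr (_ :: map _ _).
  by apply: eq_filter => q /=; rewrite /item_le /= leq_add2r.
pose f (p : item) s := (memo (extend x0 x y s (holds p.1)), p.2 + wt s).
have f_shift c : [seq f p s | p <- shift d P, s <- c] =
                 shift d [seq f p s | p <- P, s <- c].
  rewrite /shift map_allpairs allpairs_mapl.
  by apply: eq_allpairs => // p s; rewrite /f /= addnAC.
by rewrite /pstep f_shift -prune_shift /shift filter_map.
Qed.

Lemma frontier_step_ok spokes x0 x1 i X d : frontier spokes x0 x1 i X d ->
  frontier spokes x0 x1 i.+1 (frontier_step spokes x0 X) d.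
Proof.
move=> fX x xx0 xx1 xs.
have [j ji|P XP aP] := fX x xx0 xx1; first exact/xs/leqW.
(* Pruning may replace the computed node by one with the same state and a weaker profile, which is
   achievable all the more. *)
have [|[y Q] Yn] := @prune_le _ node_le
  [seq (y, pstep x0 n.1 y n.2) | n <- X, y <- succs spokes n.1]
  (x i.+1, pstep x0 (x i) (x i.+1) P) node_le_refl node_le_trans.
  apply/allpairsPdep; exists (x i, P), (x i.+1); split=> //=.
  exact: xs.
rewrite /node_le /=; case: eqP => // yx PQ; exists Q; first by rewrite -yx.
apply: achievable_dominates (achievable_step aP) _.
by rewrite xx0 pstep_shift dominates_shift.
Qed.

Lemma frontier_iter spokes x0 x1 i X d k : frontier spokes x0 x1 i X d ->
  frontier spokes x0 x1 (i + k) (iter k (frontier_step spokes x0) X) d.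
Proof.
move=> fX; elim: k => [|k IH] /=; first by rewrite addn0.
by rewrite addnS; exact: frontier_step_ok.
Qed.

Definition frontier_le (d : nat) (X Y : seq node) : bool :=
  all (fun n => has (node_le^~ n) [seq (m.1, shift d m.2) | m <- Y]) X.

Lemma frontier_weaken spokes x0 x1 i X Y d e : frontier spokes x0 x1 i X d ->
  frontier_le e X Y -> frontier spokes x0 x1 i Y (e + d).
Proof.
move=> fX /allP XY x xx0 xx1 xs; have [P XP aP] := fX x xx0 xx1 xs.
have /hasP[_ /mapP[[y Q] YQ ->]] := XY _ XP.
rewrite /node_le /=; case: eqP => // <- PQ; exists Q => //.
rewrite -shift_shift; apply: achievable_dominates aP _.
by rewrite dominates_shift.
Qed.

Lemma frontier_periodic spokes x0 x1 i X p e m : frontier spokes x0 x1 i X 0 ->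
    frontier_le e (iter p (frontier_step spokes x0) X) X ->
  frontier spokes x0 x1 (i + p * m) X (e * m).
Proof.
move=> fX le; elim: m => [|m IH]; first by rewrite !muln0 addn0.
rewrite !mulnS [p + _]addnC addnA.
apply: frontier_weaken le; exact: frontier_iter.
Qed.

Lemma subtt t : subt t t.
Proof. by rewrite /subt !implybb. Qed.

Lemma frontier1_ok spokes x0 x1 : frontier spokes x0 x1 1 (frontier1 x0 x1) 0.
Proof.
move=> x xx0 xx1 _; rewrite xx1; eexists; first exact: mem_head.
move=> _ /predU1P[->|//]; exists (fun=> edges_at x0 x1); split.
- by case=> // _; rewrite xx0 xx1 subtt.
- by rewrite big_ord1 addn0.
- by move=> e f; rewrite memoK /= xx0 xx1.
Qed.

(** The quotient [(n + 9) %/ 7] is the ceiling of [(n + 3) / 7]. *)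
Definition bound (n : nat) : nat := (n + 9) %/ 7 + delta n.

Lemma bound_period n e : bound (n + 7 * e) = bound n + e.
Proof.
rewrite /bound /delta [n + _]addnC mulnC -addnA divnMDl // modnMDl.
by rewrite -addnA addnC.
Qed.

Definition closes (x0 : state) (c : nat) (X : seq node) : bool :=
  all (fun n => (n.1 == x0) ==>
                has (fun p => irreflexiveb p.1 && (p.2 <= c)) n.2) X.

Lemma irreflexivebP R : reflect (forall e, ~~ holds R e e) (irreflexiveb R).
Proof. by apply: (iffP allP) => [RP e|RP e _ //]; exact/RP/mem_triples. Qed.

Lemma frontier_closes spokes x0 x1 n X d c x :
    frontier spokes x0 x1 n X d -> closes x0 c X ->
    x 0 = x0 -> x 1 = x1 -> x n = x0 -> steps spokes x n ->
  exists s : nat -> state,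
    [/\ forall j, j < n -> subt (s j) (edges_at (x j) (x j.+1)),
        \sum_(j < n) wt (s j) <= c + d & forall e, ~~ alt x s n e e].
Proof.
move=> fX /allP cX xx0 xx1 xn xs; have [P XP aP] := fX x xx0 xx1 xs.
have /implyP := cX _ XP; rewrite xn eqxx => /(_ isT)/hasP[p pP].
move=> /andP[/irreflexivebP p_irr pc].
have [s [s_sub s_wt s_alt]] := aP _ (map_f _ pP).
exists s; split=> //; first by rewrite (leq_trans s_wt) //= leq_add2r.
by move=> e; apply: contra (p_irr e) => /s_alt.
Qed.

(* [bound] grows by 1 every 7 positions; without spokes the state has period 4,
   so that a period of 28 is needed there. *)
Definition frontier_check (spokes : bool) (x1 : state) (e : nat) : bool :=
  let X := iter 33 (frontier_step spokes B0) (frontier1 B0 x1) in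
  let T := traject (frontier_step spokes B0) X (7 * e).+1 in
  frontier_le e (nth X T (7 * e)) X &&
  all (fun r => closes B0 (bound (34 + r)) (nth X T r)) (iota 0 (7 * e)).

Lemma upper_walk spokes x1 e n x : 0 < e -> frontier_check spokes x1 e -> 34 <= n ->
    x 0 = B0 -> x 1 = x1 -> x n = B0 -> steps spokes x n ->
  exists s : nat -> state,
    [/\ forall j, j < n -> subt (s j) (edges_at (x j) (x j.+1)),
        \sum_(j < n) wt (s j) <= bound n & forall e, ~~ alt x s n e e].
Proof.
move=> e_gt0; rewrite /frontier_check; set X := iter 33 _ _.
move=> /andP[]; rewrite nth_traject // => X_le X_closes n34 xx0 xx1 xn xs.
set r := (n - 34) %% (7 * e); set m := (n - 34) %/ (7 * e).
have n_eq : n = 34 + 7 * e * m + r.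
  by rewrite -addnA [7 * e * m]mulnC -divn_eq subnKC.
have r_lt : r < 7 * e by rewrite ltn_mod muln_gt0.
(* [frontier1] already stands at position 1, so 33 further steps reach 34. *)
have fX : frontier spokes B0 x1 34 X 0.
  exact: (frontier_iter (k := 33) (@frontier1_ok spokes B0 x1)).
have := frontier_iter (k := r) (frontier_periodic (m := m) fX X_le); rewrite -n_eq => fn.
have := allP X_closes r; rewrite mem_iota r_lt nth_traject ?(leqW r_lt) //.
move=> /(_ isT) cl; have := frontier_closes fn cl xx0 xx1 xn xs.
by rewrite -bound_period mulnA addnAC -n_eq.
Qed.

(** Matchings with a spoke: the walk starts at one, by [B0 -> B2], and later positions are free to
    have spokes. *)
Lemma frontier_check_spoke : frontier_check true B2 1.
Proof. by vm_compute. Qed.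

(** Matchings without spokes: the states repeat [B0], [B1], [B2], [B3]. *)
Lemma frontier_check_spokeless : frontier_check false B1 4.
Proof. by vm_compute. Qed.

End Upper.

(** * Lower bound for walks *)

Section Lower.
Variables (n : nat) (x : nat -> state).
Hypothesis x_nxt : forall j, j < n -> nxt (x j) (x j.+1).
Hypothesis x_closed : x n = x 0.

Definition forced (s : nat -> state) : Prop :=
  forall z, (forall j, j < n -> allowed (s j) (z j) (z j.+1)) -> z n = z 0 ->
  forall j, j <= n -> z j = x j.

(** Meaning of a profile for the lower bound, dual to [achievable]: each forcing choice is
    underestimated by some item, so smaller items may replace larger ones. *)
Definition necessary (i : nat) (P : profile) (d : nat) : Prop :=
  forall s, (forall j, j < n -> subt (s j) (edges_at (x j) (x j.+1))) -> forced s ->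
  exists2 p, p \in P &
    (forall e f, holds p.1 e f -> alt x s i e f) /\ p.2 + d <= \sum_(j < i) wt (s j).

Lemma necessary0 : necessary 0 (profile0 (x 0)) 0.
Proof.
move=> s _ _; eexists; first exact: mem_head.
by split=> [e f|]; rewrite ?memoK // big_ord0.
Qed.

Lemma allowed_self s j : (forall j, j < n -> subt (s j) (edges_at (x j) (x j.+1))) ->
  j < n -> allowed (s j) (x j) (x j.+1).
Proof. by move=> s_sub jn; rewrite /allowed x_nxt ?s_sub. Qed.

(** An alternative that rejoins [x] at position [i] could follow [x] from there to [n] and would be
    a second compatible closed walk. This justifies the filter in [pstep]. *)
Lemma forced_no_alt s i :
    (forall j, j < n -> subt (s j) (edges_at (x j) (x j.+1))) -> forced s ->
  i <= n -> ~~ alt x s i (x 0) (x i).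
Proof.
move=> s_sub s_forced i_n; apply/negP => a.
have [|z [z0 zi zP [j ji zj]]] := alt_complete _ a.
  by move=> j ji; exact/(allowed_self s_sub)/(leq_trans ji).
pose y k := if k <= i then z k else x k.
suff /(_ j (leq_trans ji i_n)) : forall k, k <= n -> y k = x k by rewrite /y ji.
apply: s_forced => [k kn|].
  rewrite /y; case: (ltngtP k i) => [ki|ki|ki].
  - exact: zP.
  - exact: allowed_self.
  - by rewrite ki zi; apply: allowed_self; rewrite // -ki.
rewrite /y z0; case: (ltngtP i n) i_n => // i_n _.
by rewrite -i_n zi i_n.
Qed.

Lemma necessary_step i P d : i < n -> necessary i P d ->
  necessary i.+1 (pstep (x 0) (x i) (x i.+1) P) d.
Proof.
move=> i_n nP s s_sub s_forced; have [p pP [p_alt p_wt]] := nP s s_sub s_forced.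
have ext e f : extend (x 0) (x i) (x i.+1) (s i) (holds p.1) e f -> alt x s i.+1 e f.
  exact: extend_mono.
have [|q qQ /item_leP[q_ext q_wt]] := pstep_le pP (s_sub i i_n) (x0 := x 0).
  by apply: contra (forced_no_alt s_sub s_forced i_n) => /ext.
exists q => //; split; first by move=> e f /q_ext; rewrite memoK => /ext.
rewrite big_ord_recr /= (leq_trans (leq_add q_wt (leqnn d))) //=.
by rewrite addnAC leq_add2r.
Qed.

Lemma necessary_dominates i P Q d e : necessary i P d -> dominates (shift e Q) P ->
  necessary i Q (e + d).
Proof.
move=> nP /dominatesP QP s s_sub s_forced.
have [p pP [p_alt p_wt]] := nP s s_sub s_forced.
have [_ /mapP[q qQ ->] /item_leP[qp qp_wt]] := QP p pP.
exists q => //; split=> [f g /qp/p_alt//|].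
by rewrite addnA (leq_trans _ p_wt) // leq_add2r.
Qed.

Fixpoint run (x0 y : state) (P : profile) (w : seq state) : profile :=
  if w is z :: w' then run x0 z (pstep x0 y z P) w' else P.

Lemma necessary_run i P d w : necessary i P d -> i + size w <= n ->
    (forall j, j < size w -> x (i + j).+1 = nth B0 w j) ->
  necessary (i + size w) (run (x 0) (x i) P w) d.
Proof.
elim: w i P => [|y w IH] i P nP /=; first by rewrite addn0.
rewrite addnS -addSn => i_n xw.
have xy : x i.+1 = y by have := xw 0 isT; rewrite addn0.
rewrite -xy; apply: IH => // [|j jw].
  by apply: necessary_step => //; apply: leq_trans i_n; rewrite ltnS leq_addr.
by have := xw j.+1 jw; rewrite addnS.
Qed.

(** A diagonal pair in the item underestimating [s] would give a closed alternative, which forcing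
    excludes; hence that item is irreflexive and costs at least [c]. *)
Lemma necessary_end P d c s : necessary n P d ->
    all (fun p => irreflexiveb p.1 ==> (c <= p.2)) P ->
    (forall j, j < n -> subt (s j) (edges_at (x j) (x j.+1))) -> forced s ->
  c + d <= \sum_(j < n) wt (s j).
Proof.
move=> nP /allP Pc s_sub s_forced; have [p pP [p_alt p_wt]] := nP s s_sub s_forced.
apply: leq_trans p_wt; rewrite leq_add2r.
have /implyP := Pc p pP; apply; apply/irreflexivebP => e; apply/negP => /p_alt a.
have [|z [z0 zn zP [j ji]]] := alt_complete _ a.
  by move=> j; exact: allowed_self.
by apply; apply: s_forced ji => //; rewrite z0.
Qed.

End Lower.

(** * Tilings attaining the bound *)

Definition tile3 : seq state := [:: B2; B3; B0].
Definition tile4 : seq state := [:: B1; B2; B3; B0].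
(** A tile lists the states reached after each of its steps; the state [B0] it starts from is the
    last one of the preceding tile. *)
Definition tiles (s : seq nat) : seq state :=
  flatten [seq if m == 3 then tile3 else tile4 | m <- s].

(* Found by search, for the lengths 34, ..., 40; each is continued by copies of
   [3 4]. *)
Definition heads : seq (seq nat) :=
  [:: [:: 3; 3; 3; 4; 3; 4; 3; 4; 3; 4];
      [:: 3; 4; 3; 4; 3; 4; 3; 4; 3; 4];
      [:: 3; 4; 4; 4; 3; 4; 3; 4; 3; 4];
      [:: 3; 3; 3; 3; 4; 3; 4; 3; 4; 3; 4];
      [:: 3; 3; 4; 3; 4; 3; 4; 3; 4; 3; 4];
      [:: 3; 4; 4; 3; 4; 3; 4; 3; 4; 3; 4];
      [:: 3; 3; 4; 3; 3; 4; 3; 3; 4; 3; 3; 4]].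

(** The domination says that appending the tiles [[3 4]], which is 7 positions, raises the necessary
    cost by at least 1, the rate at which [bound] grows. *)
Definition head_check (r : nat) : bool :=
  let w := tiles (nth [::] heads r) in
  let P := run B0 B0 (profile0 B0) w in
  [&& size w == 34 + r, nth B0 w 0 == B2, path nxt B0 w, last B0 w == B0,
      dominates (shift 1 P) (run B0 B0 P (tiles [:: 3; 4]))
    & all (fun p => irreflexiveb p.1 ==> (bound (34 + r) <= p.2)) P].

Lemma head_checkP : all head_check (iota 0 7).
Proof. by vm_compute. Qed.

Lemma lower_walk n : 34 <= n -> exists x : nat -> state,
  [/\ x 0 = B0, x 1 = B2, x n = B0, forall j, j < n -> nxt (x j) (x j.+1)
    & forall s, (forall j, j < n -> subt (s j) (edges_at (x j) (x j.+1))) ->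
        forced n x s -> bound n <= \sum_(j < n) wt (s j)].
Proof.
move=> n34; set r := (n - 34) %% 7; set k := (n - 34) %/ 7.
have n_eq : n = 34 + r + 7 * k.
  by rewrite -addnA [r + _]addnC [7 * k]mulnC -divn_eq subnKC.
have := allP head_checkP r; rewrite mem_iota ltn_mod => /(_ isT).
rewrite /head_check; set w := tiles _; set P := run _ _ _ w.
case/andP => /eqP w_size /and5P[/eqP w0 w_path /eqP w_last P_period P_end].
pose t m := flatten (nseq m (tiles [:: 3; 4])).
have t_size m : size (t m) = 7 * m.
  by rewrite size_flatten /shape map_nseq sumn_nseq.
have t_path m : path nxt B0 (t m) /\ last B0 (t m) = B0.
  by elim: m.
have wt_size : size (w ++ t k) = n by rewrite size_cat w_size t_size -n_eq.
(* The extra [B0] in front is the initial state, so the [j]-th listed state is [x j.+1]. *)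
pose x j := nth B0 (B0 :: w ++ t k) j.
have x_nxt j : j < n -> nxt (x j) (x j.+1).
  have /(pathP B0) : path nxt B0 (w ++ t k).
    by rewrite cat_path w_path w_last; case: (t_path k).
  by rewrite wt_size; apply.
have xn : x n = B0.
  rewrite /x -wt_size -last_nth last_cat w_last; exact: (t_path k).2.
exists x; split=> //.
  by rewrite /x /= nth_cat w_size.
move=> s s_sub s_forced.
(* Seen from the end of the head and [m] periods, the walk is again at [B0] with [k - m] periods to
   go. *)
have xE m j : m <= k -> x (34 + r + 7 * m + j) = nth B0 (B0 :: t (k - m)) j.
  move=> mk; have eq_w : w ++ t k = (w ++ t m) ++ t (k - m).
    by rewrite -catA /t -flatten_cat -nseqD subnKC.
  have sz : size (w ++ t m) = 34 + r + 7 * m by rewrite size_cat w_size t_size.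
  rewrite /x eq_w; case: j => [|j].
    rewrite addn0 -sz -cat_cons nth_cat ltnSn -last_nth last_cat w_last.
    exact: (t_path m).2.
  by rewrite addnS -sz /= nth_cat ltnNge leq_addr /= addKn.
have nec m : m <= k -> necessary n x (34 + r + 7 * m) P m.
  elim: m => [|m IH] mk.
    rewrite muln0 addn0 -w_size; have := @necessary_run n x x_nxt xn 0 _ 0 w.
    apply => //; first exact: necessary0.
      by rewrite add0n -wt_size size_cat leq_addr.
    by move=> j jw; rewrite add0n /x /= nth_cat jw.
  rewrite mulnS [7 + _]addnC addnA -[m.+1]add1n.
  apply: necessary_dominates P_period.
  have := @necessary_run n x x_nxt xn _ _ _ (tiles [:: 3; 4]) (IH (ltnW mk)).
  have := xE m 0 (ltnW mk); rewrite addn0 => ->; apply.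
    by rewrite -addnA -mulnSr [n in _ <= n]n_eq leq_add2l leq_mul2l mk orbT.
  move=> j j7; rewrite -addnS xE ?(ltnW mk) // -(subnSK mk).
  by rewrite -[LHS]/(nth B0 (tiles [:: 3; 4] ++ t (k - m.+1)) j) nth_cat j7.
have nec_n : necessary n x n P k by rewrite [X in necessary _ _ X]n_eq; exact: nec.
have := necessary_end x_nxt nec_n P_end s_sub s_forced.
by rewrite -bound_period -n_eq.
Qed.

Import Order.TTheory GRing.Theory Num.Theory.
Local Open Scope ring_scope.

(** * Perfect matchings as closed walks *)

Section Graph.
Variable n : nat.
Hypothesis n_gt4 : (4 < n)%N.

Definition rim (i : 'Z_n) : {set vertex n} := [set v i; v (i + 1)].
Definition inner (i : 'Z_n) : {set vertex n} := [set u i; u (i + 2%:R)].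

Definition edge (e : 'Z_n + 'Z_n + 'Z_n) : {set vertex n} :=
  match e with inl (inl i) => spoke i | inl (inr i) => rim i | inr i => inner i end.

Lemma Zn_natr k : (k%:R : 'Z_n) = (k %% n)%N :> nat.
Proof. by rewrite val_Zp_nat // (ltn_trans _ n_gt4). Qed.

Lemma natr_neq0 k : (0 < k < n)%N -> (k%:R : 'Z_n) != 0.
Proof.
move=> /andP[k0 kn]; apply/eqP => /(congr1 val) /=.
by rewrite Zn_natr modn_small //= => k0'; rewrite k0' in k0.
Qed.

Lemma natr_n : n%:R = 0 :> 'Z_n.
Proof. by apply: val_inj; rewrite /= Zn_natr modnn. Qed.

Lemma addr_fix (i : 'Z_n) k : (0 < k < n)%N -> (i + k%:R == i) = false.
Proof. by move=> k_n; rewrite -subr_eq0 addrAC subrr add0r; exact/negbTE/natr_neq0. Qed.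

Lemma addr1_fix (i : 'Z_n) : (i + 1 == i) = false.
Proof. by apply: (addr_fix i (k := 1)); rewrite (ltn_trans _ n_gt4). Qed.

Lemma in_spoke (i j : 'Z_n) :
  ((u j \in spoke i) = (j == i)) * ((v j \in spoke i) = (j == i)).
Proof. by rewrite !in_set2 !eqE /= orbF. Qed.

Lemma in_rim (i j : 'Z_n) :
  ((u j \in rim i) = false) * ((v j \in rim i) = (j == i) || (j == i + 1)).
Proof. by rewrite !in_set2. Qed.

Lemma in_inner (i j : 'Z_n) :
  ((u j \in inner i) = (j == i) || (j == i + 2%:R)) * ((v j \in inner i) = false).
Proof. by rewrite !in_set2. Qed.

Lemma u_edge j e : u j \in edge e ->
  [\/ e = inl (inl j), e = inr j | e = inr (j - 2%:R)].
Proof.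
case: e => [[]|] i /=; rewrite ?in_spoke ?in_rim ?in_inner //.
- by move/eqP->; constructor 1.
- by move=> /orP[/eqP->|/eqP->]; [constructor 2|constructor 3; rewrite addrK].
Qed.

Lemma v_edge j e : v j \in edge e ->
  [\/ e = inl (inl j), e = inl (inr j) | e = inl (inr (j - 1))].
Proof.
case: e => [[]|] i /=; rewrite ?in_spoke ?in_rim ?in_inner //.
- by move/eqP->; constructor 1.
- by move=> /orP[/eqP->|/eqP->]; [constructor 2|constructor 3; rewrite addrK].
Qed.

(** The families are separated by the types of their endpoints. Two equal rim edges with exchanged
    endpoints would need [2 = 0] in ['Z_n], two such inner edges [4 = 0]; this is where [4 < n]
    enters. *)
Lemma edge_inj : injective edge.
Proof.
move=> [[i|i]|i] f ef.
- have : u i \in edge f by rewrite -ef /= in_spoke.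
  have : v i \in edge f by rewrite -ef /= in_spoke.
  by move=> /v_edge[] -> // /u_edge[].
- have : v (i + 1) \in edge f by rewrite -ef /= in_rim eqxx orbT.
  have : v i \in edge f by rewrite -ef /= in_rim eqxx.
  move=> /v_edge[] fE; rewrite fE //= ?in_spoke ?in_rim ?subrK.
    by rewrite addr1_fix.
  rewrite addr1_fix orbF => /eqP/(congr1 (+%R^~ 1)).
  rewrite subrK -addrA -(natrD _ 1 1) => /eqP.
  by rewrite addr_fix // (ltn_trans _ n_gt4).
- have : u (i + 2%:R) \in edge f by rewrite -ef /= in_inner eqxx orbT.
  have : u i \in edge f by rewrite -ef /= in_inner eqxx.
  move=> /u_edge[] fE; rewrite fE //= ?in_spoke ?in_inner ?subrK.
    by rewrite addr_fix // (ltn_trans _ n_gt4).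
  rewrite addr_fix ?(ltn_trans _ n_gt4) // orbF => /eqP/(congr1 (+%R^~ 2%:R)).
  rewrite subrK -addrA -natrD => /eqP.
  by rewrite addr_fix.
Qed.

Lemma mem_P e : (e \in P n) = (e \in codom edge).
Proof.
apply/idP/idP.
- rewrite !in_setU => /orP[/orP[]|] /imsetP[i _ ->].
  + exact: (codom_f edge (inr i)).
  + exact: (codom_f edge (inl (inl i))).
  + exact: (codom_f edge (inl (inr i))).
- case/codomP => -[[]|] i -> /=; rewrite !in_setU -orbA; apply/or3P.
  + by constructor 2; exact: imset_f.
  + by constructor 3; exact: imset_f.
  + by constructor 1; exact: imset_f.
Qed.

Lemma edge_P e : edge e \in P n.
Proof. by rewrite mem_P codom_f. Qed.

Lemma eq_subset_P (M N : {set {set vertex n}}) : M \subset P n -> N \subset P n ->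
  (forall e, (edge e \in M) = (edge e \in N)) -> M = N.
Proof.
move=> /subsetP MP /subsetP NP MN; apply/setP => f; apply/idP/idP => fM.
- by have := MP f fM; rewrite mem_P => /codomP[e fE]; rewrite fE -MN -fE.
- by have := NP f fM; rewrite mem_P => /codomP[e fE]; rewrite fE MN -fE.
Qed.

Definition select (S : {set {set vertex n}}) (i : 'Z_n) : state :=
  (spoke i \in S, rim i \in S, inner i \in S).

Lemma card_select (S : {set {set vertex n}}) : S \subset P n -> #|S| = (\sum_i wt (select S i))%N.
Proof.
move=> /subsetP SP.
have -> : S = edge @: [set e | edge e \in S].
  apply/setP => f; apply/idP/imsetP => [fS|[e + ->]]; last by rewrite inE.
  have := SP f fS; rewrite mem_P => /codomP[e fE].
  by exists e; rewrite // inE -fE.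
rewrite card_imset; last exact: edge_inj.
set S' := [set e | _].
rewrite -sum1_card big_mkcond big_sumType big_sumType /= -!big_split /=.
apply: eq_bigr => i _; rewrite /wt /select /=.
have memS e : (edge e \in edge @: S') = (e \in S') by rewrite mem_imset //; exact: edge_inj.
rewrite -[spoke i]/(edge (inl (inl i))) -[rim i]/(edge (inl (inr i))).
rewrite -[inner i]/(edge (inr i)) !memS.
by do 3!case: ifP.
Qed.

Lemma perfect_matchingP (M : {set {set vertex n}}) : M \subset P n ->
  reflect ((forall x, exists2 f, f \in M & x \in f) /\
           (forall x f g, f \in M -> g \in M -> x \in f -> x \in g -> f = g))
          (perfect_matching (P n) M).
Proof.
move=> MP; rewrite /perfect_matching MP /=.
apply: (iffP and3P) => [[/eqP cov /trivIsetP triv _]|[cov triv]].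
  split=> [x|x f g fM gM xf xg].
    have /bigcupP[f fM xf] : x \in cover M by rewrite cov inE.
    by exists f.
  apply/eqP/negPn/negP => fg; have := triv f g fM gM fg.
  by move=> /pred0P/(_ x); rewrite /= xf xg.
split.
- apply/eqP/setP => x; rewrite inE; apply/bigcupP.
  by have [f fM xf] := cov x; exists f.
- apply/trivIsetP => f g fM gM; apply: contraR => /pred0Pn[x /andP[xf xg]].
  by apply/eqP; apply: triv xf xg.
(* A partition has no empty block, and indeed every edge contains a vertex. *)
- apply/negP => /(subsetP MP); rewrite mem_P => /codomP[[[]|] i] /esym/setP.
  + by move=> /(_ (u i)); rewrite in_spoke inE eqxx.
  + by move=> /(_ (v i)); rewrite in_rim inE eqxx.
  + by move=> /(_ (u i)); rewrite in_inner inE eqxx.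
Qed.

(** The state of [M] at the cut before position [i], its components in the order fixed for
    [state]. *)
Definition crossing (M : {set {set vertex n}}) (i : 'Z_n) : state :=
  (rim (i - 1) \in M, inner (i - 2%:R) \in M, inner (i - 1) \in M).

(** * From a perfect matching to its closed walk *)

Section PerfectMatching.
Variable M : {set {set vertex n}}.
Hypothesis pmM : perfect_matching (P n) M.

Let MP : M \subset P n. Proof. by case/andP: pmM. Qed.
Let M_cov x : exists2 f, f \in M & x \in f.
Proof. by have /(perfect_matchingP MP)[] := pmM. Qed.
Let M_inj x e f : edge e \in M -> edge f \in M -> x \in edge e -> x \in edge f -> e = f.
Proof.
have /(perfect_matchingP MP)[_ M_triv] := pmM => eM fM xe xf.
exact/edge_inj/(M_triv x).
Qed.

Lemma rim_prev i : v i \in rim (i - 1).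
Proof. by rewrite in_rim subrK eqxx orbT. Qed.

Lemma inner_prev i : u i \in inner (i - 2%:R).
Proof. by rewrite in_inner subrK eqxx orbT. Qed.

Lemma spoke_rim i : (spoke i \in M) = ~~ (rim (i - 1) \in M) && ~~ (rim i \in M).
Proof.
apply/idP/andP => [sM|[r1 r2]].
  split; apply/negP => rM.
  - suff : inl (inl i) = inl (inr (i - 1)) :> 'Z_n + 'Z_n + 'Z_n by [].
    by apply: (M_inj (x := v i)) => //; rewrite /= ?in_spoke ?rim_prev.
  - suff : inl (inl i) = inl (inr i) :> 'Z_n + 'Z_n + 'Z_n by [].
    by apply: (M_inj (x := v i)) => //; rewrite /= ?in_spoke ?in_rim eqxx.
have [f fM vf] := M_cov (v i); have := subsetP MP f fM; rewrite mem_P.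
case/codomP => e fE; move: fM vf; rewrite fE => eM /v_edge[] eE.
- by rewrite eE in eM.
- by rewrite eE /= (negbTE r2) in eM.
- by rewrite eE /= (negbTE r1) in eM.
Qed.

Lemma spoke_inner i :
  (spoke i \in M) = ~~ (inner (i - 2%:R) \in M) && ~~ (inner i \in M).
Proof.
apply/idP/andP => [sM|[r1 r2]].
  split; apply/negP => rM.
  - suff : inl (inl i) = inr (i - 2%:R) :> 'Z_n + 'Z_n + 'Z_n by [].
    by apply: (M_inj (x := u i)) => //; rewrite /= ?in_spoke ?inner_prev.
  - suff : inl (inl i) = inr i :> 'Z_n + 'Z_n + 'Z_n by [].
    by apply: (M_inj (x := u i)) => //; rewrite /= ?in_spoke ?in_inner eqxx.
have [f fM vf] := M_cov (u i); have := subsetP MP f fM; rewrite mem_P.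
case/codomP => e fE; move: fM vf; rewrite fE => eM /u_edge[] eE.
- by rewrite eE in eM.
- by rewrite eE /= (negbTE r2) in eM.
- by rewrite eE /= (negbTE r1) in eM.
Qed.

Lemma crossing_next i : crossing M (i + 1) = (rim i \in M, inner (i - 1) \in M, inner i \in M).
Proof.
rewrite /crossing addrK.
by have -> : i + 1 - 2%:R = i - 1 by rewrite (natrD _ 1 1) opprD addrA addrK.
Qed.

Lemma edges_at_crossing i : edges_at (crossing M i) (crossing M (i + 1)) = select M i.
Proof. by rewrite crossing_next /edges_at /select /= spoke_rim. Qed.

Lemma nxt_crossing i : nxt (crossing M i) (crossing M (i + 1)).
Proof.
rewrite crossing_next /= eqxx -spoke_rim -spoke_inner eqxx andbT /=.
apply/andP; split; apply/negP => /andP[r1 r2].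
- have [] : inl (inr (i - 1)) = inl (inr i) :> 'Z_n + 'Z_n + 'Z_n.
    by apply: (M_inj (x := v i)) => //; rewrite /= ?rim_prev ?in_rim ?eqxx.
  by move=> /(congr1 (+%R^~ 1)); rewrite subrK => /esym/eqP; rewrite addr1_fix.
- have [] : inr (i - 2%:R) = inr i :> 'Z_n + 'Z_n + 'Z_n.
    by apply: (M_inj (x := u i)) => //; rewrite /= ?inner_prev ?in_inner ?eqxx.
  move=> /(congr1 (+%R^~ 2%:R)); rewrite subrK => /esym/eqP.
  by rewrite addr_fix // (ltn_trans _ n_gt4).
Qed.

End PerfectMatching.

Lemma crossing_inj M N : perfect_matching (P n) M -> perfect_matching (P n) N ->
  (forall i, crossing M i = crossing N i) -> M = N.
Proof.
move=> pmM pmN MN; apply: eq_subset_P; [by case/andP: pmM|by case/andP: pmN|].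
have sel i : select M i = select N i by rewrite -!edges_at_crossing // !MN.
by case=> [[]|] i /=; case: (sel i).
Qed.

Definition label (t : 'Z_n -> state) (e : 'Z_n + 'Z_n + 'Z_n) : bool :=
  match e with
  | inl (inl i) => (t i).1.1
  | inl (inr i) => (t i).1.2
  | inr i => (t i).2
  end.

Definition edge_set (t : 'Z_n -> state) : {set {set vertex n}} :=
  edge @: [set e | label t e].

Lemma mem_edge_set t e : (edge e \in edge_set t) = label t e.
Proof. by rewrite mem_imset ?inE //; exact: edge_inj. Qed.

Lemma edge_set_P t : edge_set t \subset P n.
Proof. by apply/subsetP => _ /imsetP[e _ ->]; exact: edge_P. Qed.

Lemma select_edge_set t i : select (edge_set t) i = t i.
Proof.
rewrite /select -[spoke i]/(edge (inl (inl i))) -[rim i]/(edge (inl (inr i))).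
rewrite -[inner i]/(edge (inr i)) !mem_edge_set /=.
by case: (t i) => [[]].
Qed.

(** * From a closed walk to a perfect matching *)

Section Circuit.
Variable z : 'Z_n -> state.
Hypothesis z_nxt : forall i, nxt (z i) (z (i + 1)).

Let chosen := label (fun i => edges_at (z i) (z (i + 1))).
Definition circuit_matching := edge_set (fun i => edges_at (z i) (z (i + 1))).

Lemma nxtP (e f : state) : nxt e f ->
  [/\ f.1.2 = e.2, ~~ (e.1.1 && f.1.1), ~~ (e.1.2 && f.2)
    & (~~ e.1.1 && ~~ f.1.1) = (~~ e.1.2 && ~~ f.2)].
Proof. by case: e f => [[a b] c] [[a' b'] c'] /and4P[/eqP-> ? ? /eqP]. Qed.

Lemma chosen_inner_prev i : chosen (inr (i - 2%:R)) = (z i).1.2.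
Proof.
have [+ _ _ _] := nxtP (z_nxt (i - 1)); rewrite subrK => ->.
by congr (z _).2; rewrite (natrD _ 1 1) opprD addrA subrK.
Qed.

Lemma chosen_rim_prev i : chosen (inl (inr (i - 1))) = (z i).1.1.
Proof. by rewrite /= subrK. Qed.

Lemma chosen_spoke_inner i :
  chosen (inl (inl i)) = ~~ (z i).1.2 && ~~ (z (i + 1)).2.
Proof. by have [_ _ _ <-] := nxtP (z_nxt i). Qed.

(** By the last clause of [nxt], the spoke at [i] is chosen exactly when no rim edge at [v_i] is,
    and exactly when no inner edge at [u_i] is. With the two exclusion clauses each vertex gets
    exactly one edge. *)
Lemma circuit_matching_perfect : perfect_matching (P n) circuit_matching.
Proof.
apply/(perfect_matchingP (edge_set_P _)); split.
  suff cov x : exists2 e, chosen e & x \in edge e.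
    by move=> x; have [e ce xe] := cov x; exists (edge e) => //; rewrite mem_edge_set.
  case: x => i.
  - case r1: (z i).1.2.
      by exists (inr (i - 2%:R)); rewrite ?chosen_inner_prev ?inner_prev.
    case r2: (z (i + 1)).2; first by exists (inr i); rewrite //= in_inner eqxx.
    by exists (inl (inl i)); rewrite ?chosen_spoke_inner ?r1 ?r2 //= in_spoke.
  - case r1: (z i).1.1.
      by exists (inl (inr (i - 1))); rewrite ?chosen_rim_prev ?rim_prev.
    case r2: (z (i + 1)).1.1; first by exists (inl (inr i)); rewrite //= in_rim eqxx.
    by exists (inl (inl i)); rewrite /= ?r1 ?r2 //= in_spoke.
move=> x _ _ /imsetP[e + ->] /imsetP[f + ->]; rewrite !inE -!/(chosen _) => ce cf xe xf.
congr edge; case: x xe xf => i.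
- have [_ _ ninner _] := nxtP (z_nxt i).
  by move=> /u_edge[] eE /u_edge[] fE; rewrite eE fE // in ce cf *; exfalso;
    move: ce cf ninner; rewrite ?chosen_spoke_inner ?chosen_inner_prev /=;
    do 2!case: (_.2).
- have [_ nrim _ _] := nxtP (z_nxt i).
  by move=> /v_edge[] eE /v_edge[] fE; rewrite eE fE // in ce cf *; exfalso;
    move: ce cf nrim; rewrite ?chosen_rim_prev /=; do 2!case: (_.1.1).
Qed.

(** Together with [crossing_inj] this identifies perfect matchings with closed walks of length
    [n]. *)
Lemma crossing_circuit i : crossing circuit_matching i = z i.
Proof.
rewrite /crossing -[rim (i - 1)]/(edge (inl (inr (i - 1)))).
rewrite -[inner (i - 2%:R)]/(edge (inr (i - 2%:R))).
rewrite -[inner (i - 1)]/(edge (inr (i - 1))) !mem_edge_set -!/(chosen _).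
by rewrite chosen_rim_prev chosen_inner_prev /= subrK; case: (z i) => [[]].
Qed.

End Circuit.

(** * Forcing sets *)

Lemma subset_select (S M : {set {set vertex n}}) : S \subset P n ->
  reflect (forall i, subt (select S i) (select M i)) (S \subset M).
Proof.
move=> /subsetP SP; apply: (iffP subsetP) => [SM i|SM f fS].
  by apply/and3P; split; apply/implyP; exact: SM.
have := SP f fS; rewrite mem_P => /codomP[e fE]; move: fS; rewrite {f}fE.
by case: e => [[]|] i; have /and3P[/implyP + /implyP + /implyP +] := SM i.
Qed.

Lemma forcing_setP (M S : {set {set vertex n}}) : S \subset P n ->
  reflect ((forall i, subt (select S i) (select M i)) /\
           (forall N, perfect_matching (P n) N ->
              (forall i, subt (select S i) (select N i)) -> N = M))
          (forcing_set (P n) M S).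
Proof.
move=> SP; apply: (iffP andP) => -[/(subset_select M SP) SM uniqM]; split=> //.
  move=> N pmN /(subset_select N SP) SN; apply/eqP.
  by have /forallP/(_ N) := uniqM; rewrite pmN SN.
apply/forallP => N; apply/implyP => pmN; apply/implyP => /(subset_select N SP) SN.
exact/eqP/uniqM.
Qed.

(** Since [M] already covers every vertex, a perfect matching containing it has no room for a
    further edge. This makes the minimum in [forcing_number] meaningful. *)
Lemma forcing_set_self (M : {set {set vertex n}}) :
  perfect_matching (P n) M -> forcing_set (P n) M M.
Proof.
move=> pmM; have MP : M \subset P n by case/andP: pmM.
have [covM _] := perfect_matchingP MP pmM.
rewrite /forcing_set subxx; apply/forallP => N; apply/implyP => pmN.
apply/implyP => MN; have NP : N \subset P n by case/andP: pmN.
have [_ trivN] := perfect_matchingP NP pmN.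
rewrite eqEsubset MN andbT; apply/subsetP => f fN.
have := subsetP NP f fN; rewrite mem_P => /codomP[e fE].
have [x xf] : exists x, x \in f.
  rewrite fE; case: e {fE} => [[]|] i; [exists (u i)|exists (v i)|exists (u i)].
  - by rewrite in_spoke.
  - by rewrite in_rim eqxx.
  - by rewrite in_inner eqxx.
have [g gM xg] := covM x; have gN := subsetP MN g gM.
by rewrite (trivN x f g).
Qed.

Lemma forcing_number_le (M S : {set {set vertex n}}) : perfect_matching (P n) M ->
  forcing_set (P n) M S -> (forcing_number (P n) M <= #|S|)%N.
Proof.
move=> /forcing_set_self fM fS; rewrite /forcing_number.
by case: arg_minnP => // S' _; exact.
Qed.

Lemma forcing_number_witness (M : {set {set vertex n}}) :
    perfect_matching (P n) M ->
  exists2 S, forcing_set (P n) M S & forcing_number (P n) M = #|S|.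
Proof.
move=> /forcing_set_self fM; rewrite /forcing_number.
by case: arg_minnP => // S fS _; exists S.
Qed.

Lemma big_Zn (F : nat -> nat) (r : 'Z_n) :
  (\sum_(i : 'Z_n) F (i - r)%R = \sum_(j < n) F j)%N.
Proof.
rewrite (reindex_inj (addIr r)) (eq_bigr (fun i : 'Z_n => F i)) => [|i _]; last by rewrite addrK.
rewrite -!(big_mkord xpredT F); congr bigop; congr index_iota.
by rewrite Zp_cast // (ltn_trans _ n_gt4).
Qed.

Lemma val_Zn_lt (i : 'Z_n) : (i < n)%N.
Proof. by rewrite -[X in (_ < X)%N](@Zp_cast n) // (ltn_trans _ n_gt4). Qed.

(** * Runs between spokes and the walks of [M2] *)

Definition turn (e : state) : state := let: (a, b, c) := e in (~~ a, c, ~~ b).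

(** Without the spoke, [v_i] and [u_i] each use exactly one of their two other edges, so the next
    state is determined. *)
Lemma nxt_turn e f : nxt e f -> ~~ (edges_at e f).1.1 -> f = turn e.
Proof. by case: e f => [[[] []] []] [[[] []] []]. Qed.

Lemma nxt_spoke e f : nxt e f -> (edges_at e f).1.1 ->
  e = (false, false, e.2) /\ f = (false, e.2, false).
Proof. by case: e f => [[[] []] []] [[[] []] []]. Qed.

Lemma iter_turn g e : iter g turn e = iter (g %% 4) turn e.
Proof.
rewrite {1}(divn_eq g 4) addnC iterD; congr iter.
by elim: (g %/ 4)%N => [//|k IH]; rewrite mulSn iterD IH; case: e {IH} => [[[] []] []].
Qed.

Section Runs.
Variable M : {set {set vertex n}}.
Hypothesis pmM : perfect_matching (P n) M.

Lemma crossing_spoke i : spoke i \in M ->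
  crossing M i = (false, false, (crossing M i).2) /\
  crossing M (i + 1) = (false, (crossing M i).2, false).
Proof.
by move=> sM; apply: nxt_spoke; [exact: nxt_crossing|rewrite edges_at_crossing].
Qed.

Lemma crossing_turn i : spoke i \notin M -> crossing M (i + 1) = turn (crossing M i).
Proof.
by move=> sM; apply: nxt_turn; [exact: nxt_crossing|rewrite edges_at_crossing].
Qed.

Lemma crossing_run i g : (forall h, (h < g)%N -> spoke (i + h%:R) \notin M) ->
  crossing M (i + g%:R) = iter g turn (crossing M i).
Proof.
elim: g => [|g IH] sM; first by rewrite addr0.
rewrite -natr1 addrA crossing_turn; last exact: sM.
by rewrite IH // => h hg; apply/sM/ltnW.
Qed.

(** After a spoke the state is [(false, c, false)], and [turn], which has order 4, must lead it to a
    state [(false, false, _)]. This takes 2 steps modulo 4 if [c] holds and 0 otherwise. *)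
Lemma crossing_consecutive i g : consecutive_spokes M i g ->
  (g %% 4 = if (crossing M i).2 then 2 else 0)%N.
Proof.
case/and3P => /crossing_spoke[_ c1] s2 /forallP no.
have := @crossing_run (i + 1) g.
have natS h : i + 1 + h%:R = i + h.+1%:R by rewrite -addrA -natr1 [1 + _]addrC.
rewrite natS c1 iter_turn => /(_ _)/wrap[h hg|].
  by rewrite natS; exact: (no (Ordinal hg)).
have [-> _] := crossing_spoke s2; have := ltn_pmod g (isT : (0 < 4)%N).
by case: (crossing M i).2; case: (g %% 4)%N => [|[|[|[]]]].
Qed.

Lemma next_spoke i : spoke i \in M -> exists g : 'I_n, consecutive_spokes M i g.
Proof.
move=> sM; have ex : exists g, spoke (i + g.+1%:R) \in M.
  (* One full round returns to [spoke i] itself; for a single spoke this is the gap [n - 1]. *)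
  by exists n.-1; rewrite prednK ?(ltn_trans _ n_gt4) // natr_n addr0.
have [g gM g_min] := ex_minnP ex.
have g_n : (g < n)%N.
  rewrite -[X in (_ < X)%N](@prednK n) ?(ltn_trans _ n_gt4) // ltnS g_min //.
  by rewrite prednK ?(ltn_trans _ n_gt4) // natr_n addr0.
exists (Ordinal g_n); rewrite /consecutive_spokes sM gM; apply/forallP => h.
by apply/negP => /g_min; rewrite leqNgt ltn_ord.
Qed.

(** A rotation puts every member of [M2] into one of the two starting positions covered by the
    computed checks. *)
Lemma M2_start : M \in M2 n -> exists2 r, crossing M r = B0 &
  crossing M (r + 1) = B2 \/
  crossing M (r + 1) = B1 /\ forall i, spoke i \notin M.
Proof.
rewrite inE => /andP[_] /orP[/andP[/existsP[i sM] /forallP gaps]|].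
  have [g cg] := next_spoke sM.
  have /forallP/(_ g)/implyP/(_ cg)/eqP := gaps i.
  have -> := crossing_consecutive cg; have [ci ci1] := crossing_spoke sM.
  case c: (crossing M i).2; last by [].
  by move=> _; exists i; [rewrite ci c|left; rewrite ci1 c].
case/and3P => /forallP no n4 /existsP[i /eqP ME].
have k0 : (0 < n %/ 4)%N by rewrite divn_gt0 // ltnW // ltnW.
have [rM i0M i1M] : [/\ rim (i + 1) \in M, inner i \in M & inner (i + 1) \in M].
  rewrite ME; split; apply/bigcupP; exists (Ordinal k0) => //; rewrite muln0 !add0n.
  - rewrite /rim -addrA -(natrD _ 1 1) !inE eqxx ?orbT //.
  - by rewrite /inner addr0 !inE eqxx.
  - by rewrite /inner -addrA -(natrD _ 1 2) !inE eqxx ?orbT.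
have c2 : crossing M (i + 2%:R) = B1.
  by rewrite (natrD _ 1 1) addrA crossing_next // addrK rM i0M i1M.
have run k : crossing M (i + 2%:R + k%:R) = iter k turn B1.
  by rewrite crossing_run ?c2 // => h _; exact: no.
(* The state at [i + 2] is [B1]; three turns lead to [B0], and a fourth one back to [B1]. *)
exists (i + 2%:R + 3%:R); first by rewrite run.
by right; split => //; rewrite -addrA -(natrD _ 3 1) run.
Qed.

End Runs.

(** * Transfer of the bounds from walks to matchings *)

Lemma crossing_walk M r : perfect_matching (P n) M ->
  forall j, nxt (crossing M (r + j%:R)) (crossing M (r + j.+1%:R)).
Proof. by move=> pmM j; rewrite -natr1 addrA; exact: nxt_crossing. Qed.

(** A perfect matching containing the chosen edges gives a compatible closed walk; by [alt_sound] it
    agrees with [x], or else it is a diagonal pair of [alt]. *)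
Lemma forcing_of_walk M r s : perfect_matching (P n) M ->
    let x j := crossing M (r + j%:R) in
    (forall j, (j < n)%N -> subt (s j) (edges_at (x j) (x j.+1))) ->
    (forall e, ~~ alt x s n e e) ->
  (forcing_number (P n) M <= \sum_(j < n) wt (s j))%N.
Proof.
move=> pmM x s_sub s_alt; pose S := edge_set (fun i => s (i - r)%R).
have <- : #|S| = (\sum_(j < n) wt (s j))%N.
  rewrite card_select ?edge_set_P // -(big_Zn (fun j => wt (s j)) r).
  by apply: eq_bigr => i _; rewrite select_edge_set.
have sub_nat j : (j < n)%N -> select S (r + j%:R) = s j.
  by move=> jn; rewrite select_edge_set addrAC subrr add0r Zn_natr modn_small.
have from_r i : i = r + (nat_of_ord (i - r)%R)%:R by rewrite natr_Zp addrC subrK.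
have edges_x N j : perfect_matching (P n) N ->
    edges_at (crossing N (r + j%:R)) (crossing N (r + j.+1%:R)) = select N (r + j%:R).
  by move=> pmN; rewrite -natr1 addrA edges_at_crossing.
apply: forcing_number_le => //; apply/(forcing_setP _ (edge_set_P _)); split.
  move=> i; rewrite (from_r i) sub_nat ?val_Zn_lt // -edges_x //.
  exact/s_sub/val_Zn_lt.
move=> N pmN SN; pose z j := crossing N (r + j%:R).
have [|zx|a] := @alt_sound x s z n.
- move=> j jn; apply/andP; split; first exact: crossing_walk.
  by rewrite edges_x // -sub_nat //; exact: SN.
- apply: crossing_inj => // i; rewrite (from_r i); apply: zx.
  exact/ltnW/val_Zn_lt.
- have zn : z n = z 0 by rewrite /z natr_n.
  by have := s_alt (z 0); rewrite zn in a; rewrite a.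
Qed.

Lemma forcing_number_upper M : (34 <= n)%N -> M \in M2 n ->
  (forcing_number (P n) M <= bound n)%N.
Proof.
move=> n34 M2M; have pmM : perfect_matching (P n) M by move: M2M; rewrite inE => /andP[].
have [r cr c] := M2_start pmM M2M; pose x j := crossing M (r + j%:R).
have x0 : x 0 = B0 by rewrite /x addr0.
have xn : x n = B0 by rewrite /x natr_n addr0.
suff [s [s_sub s_wt s_alt]] : exists s : nat -> state,
    [/\ forall j, (j < n)%N -> subt (s j) (edges_at (x j) (x j.+1)),
        (\sum_(j < n) wt (s j) <= bound n)%N & forall e, ~~ alt x s n e e].
  exact: leq_trans (forcing_of_walk pmM s_sub s_alt) s_wt.
case: c => [x1|[x1 no]].
  apply: (upper_walk _ frontier_check_spoke) => // j _.
  by rewrite mem_succs crossing_walk.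
apply: (upper_walk _ frontier_check_spokeless) => // j _.
by rewrite mem_succs crossing_walk // /x -natr1 addrA edges_at_crossing // no.
Qed.

Definition parity (e : state) : bool := e.1.1 (+) e.1.2 (+) e.2.

Lemma nxt_parity e f : nxt e f -> parity f = parity e.
Proof. by case: e f => [[[] []] []] [[[] []] []]. Qed.

Lemma forcing_number_lower : (34 <= n)%N ->
  exists2 M, M \in M2 n & (bound n <= forcing_number (P n) M)%N.
Proof.
move=> n34; have [x [x0 x1 xn x_nxt x_bound]] := lower_walk n34.
(* A walk is read on residues; position [n] becomes 0, which is why [z n = z 0] is required. *)
have on_Zn (z : nat -> state) j : z n = z 0 -> (j <= n)%N -> z (j%:R : 'Z_n) = z j.
  move=> zn; rewrite leq_eqVlt => /predU1P[->|jn]; first by rewrite natr_n zn.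
  by rewrite Zn_natr modn_small.
have on_succ (z : nat -> state) (i : 'Z_n) : z n = z 0 -> z (i + 1)%R = z i.+1.
  by move=> zn; rewrite -[in LHS](natr_Zp i) natr1 on_Zn // val_Zn_lt.
have xn0 : x n = x 0 by rewrite xn x0.
have x_circuit i : nxt (x (i : 'Z_n)) (x (i + 1)%R).
  by rewrite on_succ //; exact/x_nxt/val_Zn_lt.
pose M := circuit_matching x; have pmM := circuit_matching_perfect x_circuit.
have cM i : crossing M i = x i by exact: crossing_circuit.
exists M.
  rewrite inE pmM; apply/orP; left; apply/andP; split.
    apply/existsP; exists 0; rewrite -[_ \in _]/((select M 0).1.1).
    by rewrite select_edge_set on_succ //= x0 x1.
  apply/forallP => i; apply/forallP => g; apply/implyP => cg.
  have /and3P[sM _ _] := cg; have [ci _] := crossing_spoke pmM sM.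
  rewrite (crossing_consecutive pmM cg).
  (* At a spoke the first two components vanish, so odd parity makes the third one true and the gap
     2 modulo 4. Parity is inherited from [B0] along the walk. *)
  suff : parity (crossing M i) by rewrite ci /parity /= => ->.
  rewrite cM; elim: (i : nat) (ltnW (val_Zn_lt i)) => [|j IH] jn; first by rewrite x0.
  by rewrite (nxt_parity (x_nxt j jn)) IH // ltnW.
have [S fS ->] := forcing_number_witness pmM.
have SP : S \subset P n.
  by have /andP[SM _] := fS; apply: subset_trans SM _; case/andP: pmM.
have [SM uniqM] := forcing_setP M SP fS.
pose s j := select S j%:R.
have s_Zn (i : 'Z_n) : s i = select S i by rewrite /s natr_Zp.
have -> : #|S| = (\sum_(j < n) wt (s j))%N.
  rewrite card_select // -(big_Zn (fun j => wt (s j)) 0).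
  by apply: eq_bigr => i _; rewrite subr0 s_Zn.
apply: x_bound => [j jn|z z_allowed zn j].
  have := SM j%:R; rewrite -(edges_at_crossing pmM) !cM on_succ // Zn_natr.
  by rewrite modn_small.
have z_circuit i : nxt (z (i : 'Z_n)) (z (i + 1)%R).
  by rewrite on_succ //; have /andP[] := z_allowed i (val_Zn_lt i).
have zM : circuit_matching z = M.
  apply: uniqM; first exact: circuit_matching_perfect.
  move=> i; rewrite select_edge_set on_succ // -s_Zn.
  by have /andP[] := z_allowed i (val_Zn_lt i).
move=> jn; rewrite -(on_Zn z) // -(on_Zn x) // -cM -zM.
by rewrite crossing_circuit.
Qed.

End Graph.

(** * The ceiling as a natural quotient, and the conclusion *)

Lemma ceil_natr_div (m d : nat) : (0 < d)%N ->
  Num.ceil (m%:R / d%:R : rat) = ((m + d.-1) %/ d)%N.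
Proof.
move=> d0; have dR : 0 < d%:R :> rat by rewrite ltr0n.
have le k : (Num.ceil (m%:R / d%:R : rat) <= Posz k) = (m <= k * d)%N.
  by rewrite ceil_le_int ler_pdivrMr // -natrM ler_nat.
have : 0 <= Num.ceil (m%:R / d%:R : rat).
  by rewrite ceil_ge0 (lt_le_trans (y := 0)) // divr_ge0.
case E: (Num.ceil _) => [c|//] _; congr Posz; apply/eqP; rewrite eqn_leq.
have leN k : (c <= k)%N = (m <= k * d)%N by rewrite -le E.
rewrite leN -[_ && _]andbC; apply/andP; split.
  rewrite -ltnS ltn_divLR // mulSn -[d in (_ < d + _)%N](prednK d0) addSn ltnS.
  by rewrite [(d.-1 + _)%N]addnC leq_add2r -leN.
have := divn_eq (m + d.-1) d; have := ltn_pmod (m + d.-1) d0.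
by rewrite -[X in (_ < X)%N](prednK d0) ltnS => lt eq; rewrite -(leq_add2r d.-1) {1}eq leq_add2l.
Qed.

Theorem theorem4p1 (n : nat) (hn : (34 <= n)%N) :
  (\max_(M in M2 n) forcing_number (P n) M)%N%:Z
  = Num.ceil ((n%:R + 3%:R) / 7%:R : rat) + (delta n)%:Z.
Proof.
rewrite -natrD ceil_natr_div // -addnA -PoszD; congr Posz; apply/eqP; rewrite eqn_leq.
have n_gt4 : (4 < n)%N by rewrite (leq_trans _ hn).
apply/andP; split.
  by apply/bigmax_leqP => M; exact: forcing_number_upper.
have [M MM2 le] := forcing_number_lower n_gt4 hn.
exact: leq_trans le (leq_bigmax_cond _ MM2).
Qed.
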